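(* Let $k\ge 2$ and $n>k$ be integers, and let $1\le h\le k$. Let $T$ be an affine equivariant location estimator on $\mathbf{R}^k$ (for data sets of size $n$) satisfying Condition $(C_h)$. Let $X=\{x_1,\dots,x_n\}\subset\mathbf{R}^k$ be a data set in general position. Then $$\mathrm{fsbv}(T,X)\le \frac{\lfloor (n-h+1)/2\rfloor}{n}.$$
   Context: A data set $X=\{x_1,\dots,x_n\}\subset\mathbf{R}^k$ is in general position if no more than $k$ of its points lie on any affine hyperplane of $\mathbf{R}^k$. A location estimator $T$ assigns to every data set of $n$ points (possibly with repetitions) in $\mathbf{R}^k$ a point $T(X)\in\mathbf{R}^k$. It is affine equivariant if $T(\{Ax_1+b,\dots,Ax_n+b\})=AT(\{x_1,\dots,x_n\})+b$ for every nonsingular $k\times k$ matrix $A$ and every $b\in\mathbf{R}^k$. Finite-sample (replacement) breakdown value: for $1\le m\le n$, let $\mathcal{X}_m$ be the collection of all data sets $X'$ obtained from $X$ by replacing some $m$ of the points of $X$ by $m$ arbitrary points of $\mathbf{R}^k$. Then $\mathrm{fsbv}(T,X)=\min\{m/n : \sup_{X'\in\mathcal{X}_m}\|T(X')-T(X)\|=\infty\}$, i.e. the smallest fraction of replaced points that can make $T$ take values arbitrarily far away. Condition $(C_h)$ (for a fixed integer $h$ with $1\le h\le k$): for every data set $X=\{x_1,\dots,x_n\}\subset\mathbf{R}^k$ in general position and every direction $u\in\mathbf{R}^k$ such that the inner products $y_i=u'x_i$ satisfy, after renumbering, $y_1=\dots=y_h<y_{h+1}\le\dots\le y_n$, there exists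 $\alpha>0$, depending only on $k$ and on $y_1,\dots,y_n$, such that $u'T(X)\ge y_h+\alpha$. *)

(* Defs.v *)
From HB Require Import structures.
From mathcomp Require Import all_boot all_order all_algebra all_fingroup.
From mathcomp Require Import boolp reals.
Set Implicit Arguments. Unset Strict Implicit. Unset Printing Implicit Defensive.
Import Order.TTheory GRing.Theory Num.Theory.
Local Open Scope ring_scope.

Section Defs.
Variables (R : realType) (k n : nat).

Definition dataset := 'I_n -> 'rV[R]_k.

Definition dotp (u x : 'rV[R]_k) : R := \sum_(j < k) u 0 j * x 0 j.

Definition enorm (v : 'rV[R]_k) : R := Num.sqrt (\sum_(j < k) (v 0 j) ^+ 2).

Definition general_position (X : dataset) : Prop :=
  forall (u : 'rV[R]_k) (c : R), u != 0 ->
    (#|[set i : 'I_n | dotp u (X i) == c]| <= k)%N.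

(* T is a function of the multiset of points: invariant under renumbering *)
Definition perm_invariant (T : dataset -> 'rV[R]_k) : Prop :=
  forall (X : dataset) (s : 'S_n), T (fun i => X (s i)) = T X.

Definition affine_equivariant (T : dataset -> 'rV[R]_k) : Prop :=
  forall (A : 'M[R]_k) (b : 'rV[R]_k) (X : dataset), A \in unitmx ->
    T (fun i => X i *m A + b) = T X *m A + b.

Definition cond_C (h : nat) (T : dataset -> 'rV[R]_k) : Prop :=
  exists alpha : seq R -> R,
    forall (X : dataset) (u : 'rV[R]_k), general_position X ->
      forall (S : {set 'I_n}) (c : R),
        #|S| = h ->
        (forall i, i \in S -> dotp u (X i) = c) ->
        (forall i, i \notin S -> c < dotp u (X i)) ->
        let ys := sort <=%R [seq dotp u (X i) | i <- enum 'I_n] in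
        0 < alpha ys /\ c + alpha ys <= dotp u (T X).

Definition replaced (m : nat) (X X' : dataset) : Prop :=
  exists S : {set 'I_n}, #|S| = m /\ forall i, i \notin S -> X' i = X i.

Definition breaks (T : dataset -> 'rV[R]_k) (X : dataset) (m : nat) : Prop :=
  forall M : R, exists X' : dataset, replaced m X X' /\ M < enorm (T X' - T X).

(* finite-sample replacement breakdown value: min { m/n : 1 <= m <= n, breaks }.
   (Defaults to 1 if no such m exists.) *)
Definition fsbv (T : dataset -> 'rV[R]_k) (X : dataset) : R :=
  \big[Order.min/1]_(m < n.+1 | (0 < m)%N && `[< breaks T X m >])
     ((m%:R : R) / n%:R).

End Defs.

(* Main.v *)
(** Choose a hyperplane [u.x = c] supporting the convex hull of [X] and carrying
    exactly [h] points: take a facet, which carries [k] points by general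
    position, and tilt it slightly.  For [v] orthogonal to [u], the shear
    [x |-> x + t (u.x - c) v] fixes the hyperplane and preserves the projections
    on [u].  Applying it to [m = floor((n-h+1)/2)] of the remaining points gives
    [Z], and its inverse maps [Z] to a data set [W] in which the other
    [n-h-m <= m] points have moved.  Both are [m]-replacements of [X], and [Z] is
    in general position for arbitrarily large [t], so Condition (C_h) gives
    [u.T(Z) >= c + alpha] with [alpha] independent of [t].  By equivariance
    [T(Z) - T(W) = t (u.T(Z) - c) v], which is unbounded in [t]. *)

Require Import Defs.
From HB Require Import structures.
From mathcomp Require Import all_boot all_order all_algebra all_fingroup.
From mathcomp Require Import boolp reals.
From mathcomp Require Import ring lra zify.
Set Implicit Arguments. Unset Strict Implicit. Unset Printing Implicit Defensive.
Import Order.TTheory GRing.Theory Num.Theory.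
Local Open Scope ring_scope.

(** * Selecting indices in finite sets *)

Lemma exists_subset_card (I : finType) (A : {set I}) (m : nat) :
  (m <= #|A|)%N -> exists2 B : {set I}, B \subset A & #|B| = m.
Proof.
move=> mA; exists [set x in take m (enum A)].
  by apply/subsetP => x; rewrite inE => /mem_take; rewrite mem_enum.
rewrite cardsE (card_uniqP _) ?take_uniq ?enum_uniq //.
by rewrite size_takel // -cardE.
Qed.

(** List [Q] first and its complement after it; the first [N] entries exhaust a small [Q] and stay
    inside a large one. *)
Lemma exists_injection_aligned (n N : nat) (Q : {set 'I_n}) : (N <= n)%N ->
  exists f : {ffun 'I_N -> 'I_n},
    [/\ injective f,
        (#|Q| <= N)%N -> forall i, i \in Q -> exists a, f a = i
      & (N <= #|Q|)%N -> forall a, f a \in Q].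
Proof.
case: N => [|N] Nn.
  exists [ffun a => widen_ord Nn a].
  split=> [[]//| |_ []//].
  by rewrite leqn0 cards_eq0 => /eqP -> i; rewrite inE.
have i0 : 'I_n by exists 0%N; lia.
pose s := enum Q ++ enum (~: Q).
have ss : size s = n.
  by rewrite size_cat -!cardE cardsC card_ord.
have us : uniq s.
  rewrite cat_uniq !enum_uniq /= andbT; apply/hasPn => x.
  by rewrite !mem_enum inE.
exists [ffun a : 'I_N.+1 => nth i0 s a]; split.
- move=> a b; rewrite !ffunE => /eqP; rewrite nth_uniq ?ss //.
  + by move/eqP/val_inj.
  + by apply: leq_trans Nn.
  + by apply: leq_trans Nn.
- move=> QN i iQ.
  have iE : i \in enum Q by rewrite mem_enum.
  have lti : (index i (enum Q) < N.+1)%N.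
    by apply: leq_trans QN; rewrite cardE index_mem.
  exists (Ordinal lti); rewrite ffunE /= nth_cat index_mem iE.
  by rewrite nth_index.
- move=> QN a; rewrite ffunE nth_cat -cardE (leq_trans (ltn_ord a) QN).
  by rewrite -mem_enum mem_nth // -cardE (leq_trans (ltn_ord a) QN).
Qed.

(** * Linear functionals on vectors in general position *)

Definition row_family {R : Type} {n N : nat} (y : 'I_n -> 'rV[R]_N)
    (f : 'I_N -> 'I_n) : 'M[R]_N := \matrix_(a, j) y (f a) 0 j.

(** Selections are finite functions, hence a finite type, so that one product can run over all
    minors. *)
Definition linear_general_position {R : comRingType} {n N : nat}
    (y : 'I_n -> 'rV[R]_N) : Prop :=
  forall f : {ffun 'I_N -> 'I_n}, injective f -> \det (row_family y f) != 0.

Definition ev {R : pzRingType} {n N : nat} (y : 'I_n -> 'rV[R]_N)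
    (a : 'cV[R]_N) (i : 'I_n) : R := (y i *m a) 0 0.

Lemma evDZ {R : comRingType} {n N : nat} (y : 'I_n -> 'rV[R]_N) a t b i :
  ev y (a + t *: b) i = ev y a i + t * ev y b i.
Proof. by rewrite /ev mulmxDr -scalemxAr !mxE. Qed.

Definition zeros {R : pzRingType} {n N : nat} (y : 'I_n -> 'rV[R]_N)
    (a : 'cV[R]_N) : {set 'I_n} := [set i | ev y a i == 0].

Lemma row_family_mul {R : comRingType} {n N : nat} (y : 'I_n -> 'rV[R]_N)
    (f : 'I_N -> 'I_n) (b : 'cV[R]_N) a :
  (row_family y f *m b) a 0 = ev y b (f a).
Proof. by rewrite /ev !mxE; apply: eq_bigr => j _; rewrite mxE. Qed.

Section LinearGeneralPosition.
Variables (R : realFieldType) (n N : nat) (y : 'I_n -> 'rV[R]_N).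
Hypothesis (Nn : (N <= n)%N) (yG : linear_general_position y).

(** Complete [Q] to [N] indices; the values there are prescribed by an invertible linear system. *)
Lemma interpolate (Q : {set 'I_n}) (b : 'I_n -> R) : (#|Q| <= N)%N ->
  exists a : 'cV[R]_N, forall i, i \in Q -> ev y a i = b i.
Proof.
move=> QN; have [f [finj fQ _]] := exists_injection_aligned Q Nn.
have fU : row_family y f \in unitmx by rewrite unitmxE unitfE yG.
exists (invmx (row_family y f) *m \col_a b (f a)) => i iQ.
have [a <-] := fQ QN i iQ.
by rewrite -row_family_mul mulmxA mulmxV // mul1mx mxE.
Qed.

Lemma card_zeros (a : 'cV[R]_N) :
  a != 0 -> (#|zeros y a| < N)%N.
Proof.
move=> a0; rewrite ltnNge; apply/negP => NQ.
have [f [finj _ fQ]] := exists_injection_aligned (zeros y a) Nn.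
have fU : row_family y f \in unitmx by rewrite unitmxE unitfE yG.
case/negP: a0; apply/eqP; rewrite -[a](mulKmx fU).
suff -> : row_family y f *m a = 0 by rewrite mulmx0.
apply/colP => c; rewrite row_family_mul mxE.
by have := fQ NQ c; rewrite inE => /eqP.
Qed.

(* Rotate a supporting hyperplane about the points it carries until it meets
   a new point.  The rotation fixes a further point [i0] off the hyperplane,
   which keeps the functional from degenerating to zero. *)
Lemma exists_support_many (a0 : 'cV[R]_N) :
  (0 < n)%N -> (forall i, 0 < ev y a0 i) ->
  forall j, (j < N)%N -> exists a : 'cV[R]_N,
    [/\ forall i, 0 <= ev y a i, exists i, ev y a i != 0
      & (j <= #|zeros y a|)%N].
Proof.
move=> n0 a0pos; elim=> [|j IH] jN.
  exists a0; split=> //; first by move=> i; exact: ltW.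
  by exists (Ordinal n0); rewrite gt_eqF.
have [a [age [i0 ai0] aj]] := IH (ltnW jN).
set S := zeros y a in aj *.
case: (ltnP j #|S|) => Sj; first by exists a; split=> //; exists i0.
have cS : #|S| = j by apply/eqP; rewrite eqn_leq Sj aj.
have i0S : i0 \notin S by rewrite inE.
have cS1 : #|i0 |: S| = j.+1 by rewrite cardsU1 i0S cS.
(* A further index is left because [j.+1 < N <= n]. Making [g] negative there ensures that the
   rotation meets some point. *)
have [j0 j0S] : exists j0, j0 \in ~: (i0 |: S).
  by apply/card_gt0P; have := cardsC (i0 |: S); rewrite card_ord cS1; lia.
rewrite inE in j0S.
have cQ : (#|j0 |: (i0 |: S)| <= N)%N by rewrite cardsU1 j0S cS1.
have [g gQ] := interpolate (fun i => if i == j0 then -1 else 0) cQ.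
have gj0 : ev y g j0 = -1 by rewrite gQ ?eqxx // !inE eqxx.
have g0 i : i \in i0 |: S -> ev y g i = 0.
  move=> iS; rewrite gQ; last by rewrite inE iS orbT.
  by case: eqP => // ij; rewrite -ij iS in j0S.
have Pj0 : ev y g j0 < 0 by rewrite gj0 ltrN10.
(* Ratio test: [i1] is a point that [a + t *: g] annihilates first as [t] grows from 0. *)
case: (@arg_minP _ _ _ j0 (fun i => ev y g i < 0)
  (fun i => ev y a i / - ev y g i) Pj0) => i1 gi1 mini1.
pose t := ev y a i1 / - ev y g i1.
have t0 : 0 <= t by rewrite divr_ge0 ?age // oppr_ge0 ltW.
have i1S : i1 \notin S.
  by apply/negP => iS; rewrite g0 ?ltxx // in gi1; rewrite inE iS orbT.
exists (a + t *: g); split.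
- move=> i; rewrite evDZ; case: (ltP (ev y g i) 0) => gi.
    have := mini1 _ gi; rewrite -/t ler_pdivlMr ?oppr_gt0 // mulrN.
    by rewrite -subr_ge0 opprK.
  exact: addr_ge0 (age i) (mulr_ge0 t0 gi).
- by exists i0; rewrite evDZ g0 ?mulr0 ?addr0 // !inE eqxx.
- rewrite -cS -[X in (X <= _)%N]/(1 + #|S|)%N.
  have <- : #|i1 |: S| = (1 + #|S|)%N by rewrite cardsU1 i1S.
  apply: subset_leq_card; apply/subsetP => i; rewrite in_setU1 => iS.
  rewrite inE evDZ; case/orP: iS => [/eqP->|iS].
    by rewrite /t; apply/eqP; field; rewrite lt_eqF.
  rewrite g0 ?mulr0 ?addr0; last by rewrite inE iS orbT.
  by rewrite inE in iS.
Qed.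

(* The facet functional [a] is perturbed to [a + e *: g], where [g] vanishes on
   [h] points of the facet and is positive on the others. *)
Lemma exists_support (a0 : 'cV[R]_N) (h : nat) :
  (forall i, 0 < ev y a0 i) -> (h < N)%N ->
  exists (a : 'cV[R]_N) (S : {set 'I_n}),
    [/\ #|S| = h, forall i, i \in S -> ev y a i = 0
      & forall i, i \notin S -> 0 < ev y a i].
Proof.
move=> a0pos hN.
have [a [age [i0 ai0] aN]] : exists a : 'cV[R]_N,
    [/\ forall i, 0 <= ev y a i, exists i, ev y a i != 0
      & (N.-1 <= #|zeros y a|)%N].
  by apply: exists_support_many a0pos _ _; lia.
set F := zeros y a in aN.
have FN : (#|F| < N)%N.
  apply: card_zeros; apply: contraNneq ai0 => ->.
  by rewrite /ev mulmx0 mxE.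
have [S SF cS] : exists2 S : {set 'I_n}, S \subset F & #|S| = h.
  by apply: exists_subset_card; lia.
have [g gF] := interpolate (fun i => if i \in S then 0 else 1) (ltnW FN).
have Pi0 : i0 \notin F by rewrite inE.
(* With [e] the minimal ratio, off the facet [ev y a i >= e * (|ev y g i| + 1)], which exceeds
   [- e * ev y g i]. The added 1 gives strictness and avoids division by zero. *)
case: (@arg_minP _ _ _ i0 (fun i => i \notin F)
  (fun i => ev y a i / (`|ev y g i| + 1)) Pi0) => i1 Fi1 mini1.
set e := ev y a i1 / _ in mini1.
have den i : 0 < `|ev y g i| + 1 by rewrite ltr_wpDl.
have e0 : 0 < e.
  rewrite divr_gt0 // lt_neqAle age andbT eq_sym.
  by move: Fi1; rewrite inE.
exists (a + e *: g), S; split=> // i iS.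
  have iF := subsetP SF _ iS.
  rewrite evDZ gF // iS mulr0 addr0.
  by move: iF; rewrite inE => /eqP.
rewrite evDZ; have [iF|iF] := boolP (i \in F).
  by rewrite gF // (negPf iS) mulr1 ltr_wpDl // age.
have := mini1 _ iF; rewrite ler_pdivlMr //.
have : - (e * `|ev y g i|) <= e * ev y g i.
  by rewrite -mulrN ler_pM2l // lerNl -normrN ler_norm.
rewrite mulrDr mulr1; lra.
Qed.

End LinearGeneralPosition.

(** * Generic members of a pencil *)

Lemma exists_nonroot_gt (R : realFieldType) (p : {poly R}) (M : R) :
  p != 0 -> exists2 t, M < t & p.[t] != 0.
Proof.
move=> p0; apply/not_exists2P => H.
pose s := [seq M + i.+1%:R | i <- iota 0 (size p)].
have : (size s < size p)%N.
  apply: max_poly_roots => //.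
    apply/allP => _ /mapP[i _ ->]; rewrite rootE.
    have [|/negP] := H (M + i.+1%:R); last by rewrite negbK.
    by rewrite ltrDl ltr0Sn.
  rewrite map_inj_uniq ?iota_uniq // => i j /addrI /eqP.
  by rewrite eqr_nat => /eqP [].
by rewrite size_map size_iota ltnn.
Qed.

Lemma det_pencil_poly (R : comRingType) (N : nat) (A B : 'M[R]_N) :
  exists p : {poly R}, forall t, p.[t] = \det (A + t *: B).
Proof.
exists (\det (\matrix_(i, j) ((A i j)%:P + (B i j)%:P * 'X))) => t.
rewrite -horner_evalE -det_map_mx; congr (\det _).
by apply/matrixP => i j; rewrite !mxE /= horner_evalE !hornerE mulrC.
Qed.

(* Each minor is a polynomial in [t] that is nonzero at [t = 0]. *)
Lemma linear_general_position_pencil (R : realFieldType) (n N : nat)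
    (y s : 'I_n -> 'rV[R]_N) (M : R) : linear_general_position y ->
  exists2 t, M < t & linear_general_position (fun i => y i + t *: s i).
Proof.
move=> yG.
have /(_ _)/cid-/all_sig[p pE] := fun f : {ffun 'I_N -> 'I_n} =>
  det_pencil_poly (row_family y f) (row_family s f).
(* A non-root of the product avoids the roots of all minors at once. *)
pose q := \prod_(f : {ffun 'I_N -> 'I_n} | injectiveb f) p f.
have [|t Mt qt] := @exists_nonroot_gt R q M.
  apply/prodf_neq0 => f /injectiveP fi; apply: contra_neq (yG f fi) => pf.
  by have := pE f 0; rewrite pf horner0 scale0r addr0.
exists t => // f fi; move: qt; rewrite horner_prod => /prodf_neq0.
move/(_ f (introT (injectiveP f) fi)); rewrite pE.
suff -> : row_family (fun i => y i + t *: s i) f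
  = row_family y f + t *: row_family s f by [].
by apply/matrixP => i j; rewrite !mxE.
Qed.

(** * Homogeneous coordinates: affine hyperplanes as linear ones *)

Definition homog {R : realType} {k n : nat} (X : dataset R k n) (i : 'I_n) :
  'rV[R]_(k + 1) := row_mx (X i) 1%:M.

Lemma dotpE {R : realType} {k : nat} (u x : 'rV[R]_k) :
  dotp u x = (x *m u^T) 0 0.
Proof. by rewrite /dotp mxE; apply: eq_bigr => j _; rewrite mxE mulrC. Qed.

Lemma ev_homog {R : realType} {k n : nat} (X : dataset R k n) (a : 'cV[R]_(k + 1)) i :
  ev (homog X) a i = dotp (usubmx a)^T (X i) + dsubmx a 0 0.
Proof.
by rewrite /ev /homog -{1}[a]vsubmxK mul_row_col mul1mx mxE dotpE trmxK.
Qed.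

(** A vanishing minor amounts to a nonzero affine functional with [k + 1] zeros among the points;
    conversely, [card_zeros] bounds the points on a hyperplane. *)
Lemma general_positionP {R : realType} {k n : nat} (X : dataset R k n) :
  (k < n)%N -> general_position X <-> linear_general_position (homog X).
Proof.
move=> kn; have k1n : (k + 1 <= n)%N by rewrite addn1.
split=> [XG f fi | XG u c u0].
  apply/negP => /eqP detf.
  have /det0P[w w0 wf] : \det (row_family (homog X) f)^T == 0.
    by rewrite det_tr detf.
  pose a := w^T; have fa b : ev (homog X) a (f b) = 0.
    rewrite -row_family_mul -[row_family _ _]trmxK -trmx_mul.
    by rewrite wf !mxE.
  (* A functional with zero linear part is constant, and having a zero it would vanish
     identically. *)
  have ua : (usubmx a)^T != 0.
    apply: contra_neq w0 => ua.
    have k0 : 'I_(k + 1) by rewrite addn1; exact: ord0.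
    have := fa k0; rewrite ev_homog ua dotpE trmx0 mulmx0 mxE add0r => da.
    have a0 : a = 0.
      rewrite -[a]vsubmxK -[usubmx a]trmxK ua trmx0.
      by rewrite [dsubmx a]mx11_scalar da raddf0 col_mx0.
    by rewrite -[w]trmxK -/a a0 trmx0.
  have := XG _ (- dsubmx a 0 0) ua; apply/negP; rewrite -ltnNge.
  have <- : #|[set f b | b : 'I_(k + 1)]| = k.+1.
    by rewrite card_imset // card_ord addn1.
  apply: subset_leq_card; apply/subsetP => _ /imsetP[b _ ->].
  by rewrite inE -addr_eq0 -ev_homog fa.
pose a : 'cV[R]_(k + 1) := col_mx u^T (- c)%:M.
have -> : [set i | dotp u (X i) == c] = zeros (homog X) a.
  apply/setP => i; rewrite !inE ev_homog /a col_mxKu col_mxKd trmxK.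
  by rewrite mxE eqxx mulr1n subr_eq0.
rewrite -ltnS -[k.+1]addn1; apply: card_zeros => //.
apply: contra_neq u0 => a0.
by rewrite -[u]trmxK -[u^T](col_mxKu _ (- c)%:M) -/a a0 !raddf0.
Qed.

Lemma exists_supporting_hyperplane {R : realType} {k n : nat}
    (X : dataset R k n) (h : nat) :
  (h <= k)%N -> (k < n)%N -> general_position X ->
  exists (u : 'rV[R]_k) (c : R) (S : {set 'I_n}),
    [/\ #|S| = h, forall i, i \in S -> dotp u (X i) = c
      & forall i, i \notin S -> c < dotp u (X i)].
Proof.
move=> hk kn /(general_positionP _ kn) XG.
have k1n : (k + 1 <= n)%N by rewrite addn1.
(* The starting functional is the constant 1, positive at every point. *)
have [||a [S [cS aS aSC]]] :=
    @exists_support _ _ _ _ k1n XG (col_mx 0 1%:M) h.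
- by move=> i; rewrite ev_homog col_mxKu col_mxKd dotpE trmxK mulmx0 !mxE add0r.
- by rewrite addn1.
exists (usubmx a)^T, (- dsubmx a 0 0), S; split=> // i iS.
  by apply/eqP; rewrite -addr_eq0 -ev_homog aS.
by rewrite -subr_gt0 opprK -ev_homog aSC.
Qed.

Lemma exists_orthogonal {R : realType} {k : nat} (u : 'rV[R]_k) :
  (2 <= k)%N -> exists2 v : 'rV[R]_k, v != 0 & v *m u^T = 0.
Proof.
move=> k2; exists (nz_row (kermx u^T)); last exact/sub_kermxP/nz_row_sub.
rewrite nz_row_eq0 -mxrank_eq0 mxrank_ker -lt0n subn_gt0.
by apply: leq_ltn_trans (rank_leq_col _) _.
Qed.

(** * Replacements and the breakdown value *)

Lemma le_enorm {R : realType} {k : nat} (w : 'rV[R]_k) j : `|w 0 j| <= enorm w.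
Proof.
rewrite -sqrtr_sqr ler_sqrt ?sumr_ge0 // => [|i _]; last exact: sqr_ge0.
by rewrite (bigD1 j) //= lerDl sumr_ge0 // => i _; exact: sqr_ge0.
Qed.

(** A replaced point may keep its value, so [S] can be padded to exactly [m] indices. *)
Lemma replacedW {R : realType} {k n : nat} (X X' : dataset R k n)
    (m : nat) (S : {set 'I_n}) :
  (#|S| <= m <= n)%N -> (forall i, i \notin S -> X' i = X i) ->
  replaced m X X'.
Proof.
move=> /andP[Sm mn] XS.
have [|B BS cB] := @exists_subset_card _ (~: S) (m - #|S|).
  by have := cardsC S; rewrite card_ord; lia.
exists (S :|: B); split; last first.
  by move=> i; rewrite inE => /norP[iS _]; exact: XS.
rewrite cardsU cB; suff -> : S :&: B = set0 by rewrite cards0; lia.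
by apply/eqP; rewrite setI_eq0 disjoint_sym disjoints_subset.
Qed.

Lemma fsbv_le {R : realType} {k n : nat} (T : dataset R k n -> 'rV[R]_k)
    (X : dataset R k n) (m : nat) :
  (0 < m <= n)%N -> breaks T X m -> fsbv T X <= m%:R / n%:R.
Proof.
move=> /andP[m0 mn] brk; have mn1 : (m < n.+1)%N by [].
rewrite /fsbv; apply: (@bigmin_le_cond _ _ _ _ (Ordinal mn1)
  (fun m : 'I_n.+1 => _) (fun m : 'I_n.+1 => m%:R / n%:R)).
by rewrite /= m0; apply/asboolP.
Qed.

(** * Shears and equivariance *)

Definition shear {R : realType} {k : nat} (u v : 'rV[R]_k) (c t : R)
    (x : 'rV[R]_k) : 'rV[R]_k := x + (t * (dotp u x - c)) *: v.

Lemma dotp_shear {R : realType} {k : nat} (u v : 'rV[R]_k) (c t : R) x :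
  v *m u^T = 0 -> dotp u (shear u v c t x) = dotp u x.
Proof.
by move=> vu; rewrite !dotpE mulmxDl -scalemxAl vu scaler0 addr0.
Qed.

Lemma shearK {R : realType} {k : nat} (u v : 'rV[R]_k) (c t : R) x :
  v *m u^T = 0 -> shear u v c (- t) (shear u v c t x) = x.
Proof.
move=> vu; rewrite {1}/shear dotp_shear // /shear -addrA -scalerDl.
by rewrite mulNr subrr scale0r addr0.
Qed.

Lemma equivariant_shear {R : realType} {k n : nat}
    (T : dataset R k n -> 'rV[R]_k) (u v : 'rV[R]_k) (c t : R)
    (X : dataset R k n) : affine_equivariant T -> v *m u^T = 0 ->
  T (fun i => shear u v c t (X i)) = shear u v c t (T X).
Proof.
move=> Taff vu; pose B := u^T *m v.
(* Since [v] is orthogonal to [u], [B] is nilpotent and [1 - t *: B] inverts [1 + t *: B]. *)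
have BB : B *m B = 0 by rewrite /B mulmxA -(mulmxA u^T) vu mulmx0 mul0mx.
have AU : 1%:M + t *: B \in unitmx.
  apply: (proj1 (@mulmx1_unit _ _ _ (1%:M - t *: B) _)).
  rewrite mulmxDl mul1mx mulmxBr mulmx1 -scalemxAl -scalemxAr BB !scaler0.
  by rewrite subr0 subrK.
have shearE x : shear u v c t x = x *m (1%:M + t *: B) + (- (t * c)) *: v.
  rewrite mulmxDr mulmx1 -scalemxAr mulmxA [x *m _]mx11_scalar -dotpE.
  rewrite mul_scalar_mx scalerA -addrA -scalerDl /shear.
  by rewrite mulrBr.
rewrite shearE -Taff //; congr (T _); apply/funext => i; exact: shearE.
Qed.

(** * The breakdown bound *)

Theorem theorem1 (R : realType) (k n h : nat)
  (hk : (2 <= k)%N) (hn : (k < n)%N) (hh1 : (1 <= h)%N) (hhk : (h <= k)%N)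
  (T : dataset R k n -> 'rV[R]_k)
  (Tperm : perm_invariant T)
  (Taff : affine_equivariant T)
  (TC : cond_C h T)
  (X : dataset R k n) (HX : general_position X) :
  fsbv T X <= ((n - h + 1)./2)%:R / n%:R.
Proof.
set m := (n - h + 1)./2.
have m0n : (0 < m <= n)%N by rewrite /m; lia.
apply: fsbv_le => //; apply: contrapT => /existsNP[M nbrk].
have bounded X' : replaced m X X' -> enorm (T X' - T X) <= M.
  by move=> XX'; rewrite leNgt; apply/negP => ltM; apply: nbrk; exists X'.
have [u [c [S [cS uS uSC]]]] := exists_supporting_hyperplane hhk hn HX.
have [v v0 vu] := exists_orthogonal u hk.
have [j vj0] : exists j, v 0 j != 0 by exact/rV0Pn.
have [P PS cP] : exists2 P : {set 'I_n}, P \subset ~: S & #|P| = m.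
  by apply: exists_subset_card; have := cardsC S; rewrite card_ord; lia.
have [alpha TCa] := TC.
set a := alpha (sort <=%R [seq dotp u (X i) | i <- enum 'I_n]).
have a0 : 0 < a by have [] := TCa X u HX S c cS uS uSC.
pose d i : R := if i \in P then dotp u (X i) - c else 0.
(* The threshold yields [t * a * |v 0 j| > 2 * |M|]; being nonnegative, it also forces [t > 0]. The
   last coordinate 1 is left unmoved. *)
have [t Mt ZG] := linear_general_position_pencil
  (fun i => row_mx (d i *: v) 0) (2 * `|M| / (a * `|v 0 j|))
  ((general_positionP X hn).1 HX).
pose Z : dataset R k n :=
  fun i => if i \in P then shear u v c t (X i) else X i.
have {}ZG : general_position Z.
  apply/(general_positionP _ hn); congr linear_general_position: ZG.
  apply/funext => i; rewrite /homog scale_row_mx add_row_mx scaler0 addr0.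
  congr row_mx; rewrite /Z /d; case: ifP => _; first by rewrite /shear scalerA.
  by rewrite scale0r scaler0 addr0.
have uZ i : dotp u (Z i) = dotp u (X i).
  by rewrite /Z; case: ifP => // _; exact: dotp_shear.
have TZ : c + a <= dotp u (T Z).
  have [|i|] := TCa Z u ZG S c cS.
    by move=> i iS; rewrite uZ uS.
    by move=> iS; rewrite uZ uSC.
  (* [Z] and [X] have the same sorted projections, so [alpha] takes the same value [a] whatever [t]
     is. *)
  by move=> _; under eq_map => i do rewrite uZ.
pose W : dataset R k n := fun i => shear u v c (- t) (Z i).
have ZX : replaced m X Z.
  apply: (@replacedW _ _ _ _ _ _ P); first by rewrite cP leqnn; lia.
  by move=> i /negPf iP; rewrite /Z iP.
(* The inverse shear restores the points of [P] and fixes those of [S], leaving [n - h - m <= m]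
   replaced points. *)
have WX : replaced m X W.
  apply: (@replacedW _ _ _ _ _ _ (~: (S :|: P))).
    have := cardsC (S :|: P); rewrite cardsU card_ord cS cP.
    suff -> : S :&: P = set0 by rewrite cards0 /m; lia.
    by apply/eqP; rewrite setI_eq0 disjoint_sym disjoints_subset.
  move=> i; rewrite inE negbK inE /W /Z.
  case: ifP => [_ _|_]; first exact: shearK.
  by rewrite orbF => /uS ui; rewrite /shear ui subrr mulr0 scale0r addr0.
have TW : T W = shear u v c (- t) (T Z) by exact: equivariant_shear.
have := le_trans (le_enorm _ j) (bounded _ ZX).
have := le_trans (le_enorm _ j) (bounded _ WX).
rewrite TW /shear !mxE => leW leZ.
(* Triangle inequality through [T X] for the [j]-th coordinates of [T Z] and [T W]. *)
have : `|t * (dotp u (T Z) - c) * v 0 j| <= 2 * M.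
  by rewrite ler_norml; move: leW leZ; rewrite !ler_norml; lra.
have vj : 0 < `|v 0 j| by rewrite normr_gt0.
move: Mt; rewrite ltr_pdivrMr ?mulr_gt0 // => Mt.
apply/negP; rewrite -ltNge.
have t0 : 0 < t.
  rewrite -(pmulr_lgt0 _ (mulr_gt0 a0 vj)).
  by apply: le_lt_trans Mt; rewrite mulr_ge0.
have da : a <= dotp u (T Z) - c by rewrite lerBrDl.
rewrite !normrM (gtr0_norm t0) (ger0_norm (le_trans (ltW a0) da)).
apply: (@le_lt_trans _ _ (2 * `|M|)); first by rewrite ler_pM2l // ler_norm.
apply: lt_le_trans Mt _; rewrite -mulrA ler_pM2l // ler_pM2r //.
Qed.
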